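(* Let $k \geq 1$ be an integer. Every operator system $\mathcal{V} \subseteq M_{8k^{11}}(\mathbb{C})$ has either a quantum $k$-clique or a quantum $k$-anticlique.
   Context: An operator system in $M_n(\mathbb{C})$ is a complex linear subspace $\mathcal{V} \subseteq M_n(\mathbb{C})$ such that $I_n \in \mathcal{V}$ and $A \in \mathcal{V}$ implies $A^* \in \mathcal{V}$ ($A^*$ is the Hermitian adjoint). An orthogonal projection is a matrix $P$ with $P = P^2 = P^*$, and $P\mathcal{V}P = \{PAP : A \in \mathcal{V}\}$. A quantum $k$-clique of $\mathcal{V} \subseteq M_n(\mathbb{C})$ is an orthogonal projection $P \in M_n(\mathbb{C})$ of rank $k$ such that $P\mathcal{V}P = PM_n(\mathbb{C})P$, equivalently $\dim(P\mathcal{V}P) = k^2$. A quantum $k$-anticlique of $\mathcal{V}$ is an orthogonal projection $P \in M_n(\mathbb{C})$ of rank $k$ such that $P\mathcal{V}P = \mathbb{C}\cdot P$, equivalently $\dim(P\mathcal{V}P) = 1$. *)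

(* Defs.v *)
From HB Require Import structures.
From mathcomp Require Import all_boot all_order all_algebra.
From mathcomp Require Import reals.
From mathcomp.real_closed Require Import complex.

Set Implicit Arguments.
Unset Strict Implicit.
Unset Printing Implicit Defensive.

Import GRing.Theory Num.Theory.

Local Open Scope ring_scope.
Local Open Scope sesquilinear_scope.

Definition operator_system (C : numClosedFieldType) (n : nat)
    (V : {vspace 'M[C]_n}) : Prop :=
  1%:M \in V /\ (forall A : 'M[C]_n, A \in V -> A ^t* \in V).

Definition orthogonal_projection (C : numClosedFieldType) (n : nat)
    (P : 'M[C]_n) : Prop :=
  P = P *m P /\ P = P ^t*.

Definition compression (C : numClosedFieldType) (n : nat)
    (P : 'M[C]_n) (V : {vspace 'M[C]_n}) : {vspace 'M[C]_n} :=
  (linfun (mulmxr P \o mulmx P) @: V)%VS.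

Lemma compressionP (C : numClosedFieldType) (n : nat)
    (P : 'M[C]_n) (V : {vspace 'M[C]_n}) (B : 'M[C]_n) :
  reflect (exists2 A, A \in V & B = P *m A *m P) (B \in compression P V).
Proof.
by apply: (iffP memv_imgP) => -[A VA ->]; exists A; rewrite // lfunE.
Qed.

Definition quantum_clique (C : numClosedFieldType) (n k : nat)
    (V : {vspace 'M[C]_n}) (P : 'M[C]_n) : Prop :=
  [/\ orthogonal_projection P, \rank P = k &
      compression P V = compression P fullv].

Definition quantum_anticlique (C : numClosedFieldType) (n k : nat)
    (V : {vspace 'M[C]_n}) (P : 'M[C]_n) : Prop :=
  [/\ orthogonal_projection P, \rank P = k & compression P V = <[P]>%VS].

(* Main.v *)
(* Compressing V to the row space of a k x n matrix T amounts to the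
   congruence A |-> T A T^*: a k-clique is a T for which it maps V onto M_k, and
   a k-anticlique is a row-free T for which T A T^* is always a multiple of T T^*.

   Put d = 8k^4 and m = k^7, so that m d = 8k^11. Choosing vectors greedily
   gives one of two alternatives.

   (1) After some compression dim(V v) > d for all v <> 0. Then any subspace of
   V of small codimension contains a matrix of large rank: if B has maximal
   rank and v B = 0, then V v lies in the row space of B. This allows one to
   build vectors u_1, ..., u_{k^2} such that V compresses onto all diagonal
   matrices; since M_k is spanned by k^2 rank-one matrices, there is a clique.

   (2) There are m nonzero vectors to which V compresses as a space D of
   diagonal matrices. If dim D >= k^2, some k^2 of the vectors again carry all
   diagonal matrices. Otherwise Tverberg's theorem, applied to the m coordinate
   functionals on D, yields k disjointly supported combinations of the vectors
   on which all elements of D have the same expectation: an anticlique. *)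
Require Import Defs.
From mathcomp Require Import all_boot all_order all_algebra.
From mathcomp Require Import reals.
From mathcomp.real_closed Require Import complex.
From mathcomp Require Import boolp classical_sets topology normedtype
  derive.
From mathcomp Require Import ring lra zify.

Set Implicit Arguments.
Unset Strict Implicit.
Unset Printing Implicit Defensive.

Import Order.TTheory GRing.Theory Num.Theory.
Import numFieldNormedType.Exports.

Local Open Scope ring_scope.
Local Open Scope sesquilinear_scope.

(** * Congruences and compressions *)

Section Compressions.
Variable C : numClosedFieldType.

Lemma adjmxM m n p (A : 'M[C]_(m, n)) (B : 'M[C]_(n, p)) :
  (A *m B)^t* = B^t* *m A^t*.
Proof. by rewrite trmx_mul map_mxM. Qed.

Lemma adjmxD m n (A B : 'M[C]_(m, n)) : (A + B)^t* = A^t* + B^t*.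
Proof. by rewrite linearD /= map_mxD. Qed.

Lemma adjmxZ m n a (A : 'M[C]_(m, n)) : (a *: A)^t* = a^* *: A^t*.
Proof. by rewrite linearZ /= map_mxZ. Qed.

Lemma rank_adjmx m n (A : 'M[C]_(m, n)) : \rank (A^t*) = \rank A.
Proof. by rewrite mxrank_map mxrank_tr. Qed.

Lemma mulmx_adjr_eq0 n (u : 'rV[C]_n) : (u *m u^t* == 0) = (u == 0).
Proof.
apply/eqP/eqP => [|->]; last by rewrite mul0mx.
move=> /matrixP/(_ 0 0)/eqP; rewrite !mxE psumr_eq0 => [/allP H|i _].
  apply/rowP => i; have := H i (mem_index_enum i).
  by rewrite !mxE -normCK expf_eq0 normr_eq0 => /eqP.
by rewrite !mxE -normCK exprn_ge0.
Qed.

Lemma gram_unitmx m n (T : 'M[C]_(m, n)) : row_free T -> T *m T^t* \in unitmx.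
Proof.
move=> Tfree; rewrite -row_free_unit -kermx_eq0; apply/rowV0P => v /sub_kermxP.
rewrite mulmxA => vT; have /eqP : v *m T *m (v *m T)^t* = 0.
  by rewrite adjmxM mulmxA vT mul0mx.
by rewrite mulmx_adjr_eq0 mulmx_free_eq0 // => /eqP.
Qed.

(** For row-free [T], the orthogonal projection onto the row space; the inverse Gram matrix replaces
    an orthonormalisation of the rows. *)
Definition range_proj m n (T : 'M[C]_(m, n)) : 'M[C]_n :=
  T^t* *m invmx (T *m T^t*) *m T.

Lemma range_proj_orthogonal m n (T : 'M[C]_(m, n)) : row_free T ->
  orthogonal_projection (range_proj T).
Proof.
move=> /gram_unitmx GU; split; rewrite /range_proj.
  by rewrite -!mulmxA (mulmxA T (T^t*)) (mulKVmx GU).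
by rewrite !adjmxM trmxCK trmx_inv map_invmx adjmxM trmxCK mulmxA.
Qed.

Lemma rank_range_proj m n (T : 'M[C]_(m, n)) : row_free T ->
  \rank (range_proj T) = m.
Proof.
move=> Tfree; have GU := gram_unitmx Tfree; apply/eqP; rewrite eqn_leq.
rewrite (leq_trans (mxrankM_maxr _ _) (rank_leq_row T)) /=.
have TP : T *m range_proj T = T by rewrite !mulmxA mulmxV // mul1mx.
by rewrite -{1}(eqP Tfree) -{1}TP mxrankM_maxr.
Qed.

(** Thus the compression of [A] depends only on [T *m A *m T^t*]. *)
Lemma range_proj_congr m n (T : 'M[C]_(m, n)) (A : 'M_n) :
  range_proj T *m A *m range_proj T =
  T^t* *m invmx (T *m T^t*) *m (T *m A *m T^t*) *m (invmx (T *m T^t*) *m T).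
Proof. by rewrite /range_proj !mulmxA. Qed.

Lemma clique_of_onto n k (V : {vspace 'M[C]_n}) (T : 'M[C]_(k, n)) :
  (forall X, exists2 A, A \in V & T *m A *m T^t* = X) ->
  quantum_clique k V (range_proj T).
Proof.
move=> onto; have Tfree : row_free T.
  have [A _ TA] := onto 1%:M; apply/row_freeP.
  by exists (A *m T^t*); rewrite mulmxA.
split; [exact: range_proj_orthogonal | exact: rank_range_proj |].
apply/eqP; rewrite eqEsubv limgS ?subvf //=; apply/subvP => _ /compressionP[B _ ->].
have [A VA TA] := onto (T *m B *m T^t*).
by apply/compressionP; exists A; rewrite // !range_proj_congr TA.
Qed.

Lemma anticlique_of_scalar n k (V : {vspace 'M[C]_n}) (T : 'M[C]_(k, n)) :
  1%:M \in V -> row_free T ->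
  (forall A, A \in V -> exists c, T *m A *m T^t* = c *: (T *m T^t*)) ->
  quantum_anticlique k V (range_proj T).
Proof.
move=> V1 Tfree scal.
have [PP _] := range_proj_orthogonal Tfree; have GU := gram_unitmx Tfree.
split; [exact: range_proj_orthogonal | exact: rank_range_proj |].
apply/eqP; rewrite eqEsubv; apply/andP; split; last first.
  apply/subvP => _ /vlineP[c ->]; apply/memvZ/compressionP.
  by exists 1%:M; rewrite // mulmx1.
apply/subvP => _ /compressionP[A /scal[c TA] ->]; apply/vlineP; exists c.
rewrite range_proj_congr TA -scalemxAr -scalemxAl; congr (_ *: _).
by rewrite /range_proj -!mulmxA (mulmxA T (T^t*)) (mulKVmx GU).
Qed.

(* The columns of T are e_p, e_p + e_q (p < q) and e_p + i e_q (p > q). *)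
Lemma rank_ones_span k : exists T : 'M[C]_(k, k * k), forall X : 'M[C]_k,
  exists D : 'rV_(k * k), T *m diag_mx D *m T^t* = X.
Proof.
pose e (p : 'I_k) : 'cV[C]_k := delta_mx p 0.
pose alpha p q := if p == q then e p else
  if (p < q)%N then e p + e q else e p + 'i *: e q.
pose T := \matrix_(a < k) mxvec (\matrix_(p, q) (alpha p q a 0)).
exists T; pose Q X := exists D : 'rV_(k * k), T *m diag_mx D *m T^t* = X.
have QD X Y : Q X -> Q Y -> Q (X + Y).
  case=> D <- [D' <-]; exists (D + D').
  by rewrite linearD /= mulmxDr mulmxDl.
have QZ a X : Q X -> Q (a *: X).
  by case=> D <-; exists (a *: D); rewrite linearZ /= -scalemxAr -scalemxAl.
have Q0 : Q 0 by exists 0; rewrite linear0 mulmx0 mul0mx.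
have Qa p q : Q (alpha p q *m (alpha p q)^t*).
  exists (delta_mx 0 (mxvec_index p q)); apply/matrixP => a b.
  rewrite mxE (bigD1 (mxvec_index p q)) //= big1 ?addr0 => [|s ne].
    rewrite mul_mx_diag !mxE !mxvecE !mxE !eqxx mulr1.
    by rewrite big_ord1 !mxE.
  by rewrite mul_mx_diag !mxE (negPf ne) andbF mulr0 mul0r.
have ee p q : e p *m (e q)^t* = delta_mx p q.
  rewrite /e trmx_delta map_delta_mx mul_delta_mx_cond eqxx //.
have Qd p : Q (delta_mx p p) by have := Qa p p; rewrite /alpha eqxx ee.
(* [Mp], [Mq], [M], [N] stand for E_pp, E_qq, E_pq, E_qp. Removing the diagonal units leaves M + N
   and i(M - N), which determine M and N. *)
have polar (Mp Mq M N : 'M[C]_k) : 2^-1 *: (Mp + M + (N + Mq) + -1 *: (Mp + Mq) +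
     - 'i *: (Mq + - 'i *: N + ('i *: M + Mp) + -1 *: (Mp + Mq))) = M.
  apply/matrixP => x y; rewrite !mxE; move: (Mp x y) (Mq x y) (M x y) (N x y).
  move=> a b c d; transitivity (2^-1 * (c + d - 'i * 'i * (c - d))); first by ring.
  by rewrite mulCii; field.
have polar' (Mp Mq M N : 'M[C]_k) : 2^-1 *: (Mp + M + (N + Mq) + -1 *: (Mp + Mq) +
     'i *: (Mq + - 'i *: N + ('i *: M + Mp) + -1 *: (Mp + Mq))) = N.
  apply/matrixP => x y; rewrite !mxE; move: (Mp x y) (Mq x y) (M x y) (N x y).
  move=> a b c d; transitivity (2^-1 * (c + d + 'i * 'i * (c - d))); first by ring.
  by rewrite mulCii; field.
have Qlt (p q : 'I_k) : (p < q)%N -> Q (delta_mx p q) /\ Q (delta_mx q p).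
  move=> pq; have := Qa p q; have := Qa q p; rewrite /alpha.
  have /negPf -> : p != q by rewrite neq_ltn pq.
  have /negPf -> : q != p by rewrite neq_ltn pq orbT.
  rewrite pq ltnNge (ltnW pq) /=.
  rewrite !adjmxD adjmxZ !mulmxDl !mulmxDr -!scalemxAl -!scalemxAr !ee conjCi.
  rewrite scalerA mulrN mulCii opprK scale1r => Q2 Q1.
  have := QD _ _ Q2 (QZ (-1) _ (QD _ _ (Qd p) (Qd q))).
  have := QD _ _ Q1 (QZ (-1) _ (QD _ _ (Qd p) (Qd q))).
  move=> {}Q1 {}Q2; split.
    by have := QZ 2^-1 _ (QD _ _ Q1 (QZ (- 'i) _ Q2)); rewrite polar.
  by have := QZ 2^-1 _ (QD _ _ Q1 (QZ 'i _ Q2)); rewrite polar'.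
move=> X; change (Q X); rewrite (matrix_sum_delta X).
apply: (big_ind Q) => // p _; apply: (big_ind Q) => // q _; apply: QZ.
by case: (ltngtP p q) => [/Qlt[]|/Qlt[]|/val_inj ->].
Qed.

(** Expanding the form at u + v and at u + iv gives two relations between u A v^* and v A u^* that
    force both to vanish. *)
Lemma polarization n (A : 'M[C]_n) :
  (forall u : 'rV_n, u *m A *m u^t* = 0) -> A = 0.
Proof.
move=> A0.
have sym (u v : 'rV_n) : u *m A *m v^t* + v *m A *m u^t* = 0.
  have := A0 (u + v); rewrite adjmxD mulmxDl !mulmxDr !mulmxDl.
  by rewrite !A0 add0r addr0 addrC.
have bil (u v : 'rV_n) : u *m A *m v^t* = 0.
  have := sym u ('i *: v); rewrite adjmxZ conjCi.
  rewrite -!scalemxAl -!scalemxAr scaleNr addrC => /eqP; rewrite subr_eq0.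
  move/eqP/(congr1 ( *:%R (- 'i))); rewrite !scalerA mulNr mulCii opprK !scale1r.
  move=> E; have := sym u v; rewrite E -mulr2n -scaler_nat => /eqP.
  by rewrite scaler_eq0 pnatr_eq0 => /eqP.
apply/matrixP => i j; rewrite mxE.
have /matrixP/(_ 0 0) := bil (delta_mx 0 i) (delta_mx 0 j).
rewrite trmx_delta map_delta_mx -rowE -colE !mxE //.
Qed.

(** * Large orbits and matrices of large rank *)

Definition orbit_space n (V : {vspace 'M[C]_n}) (v : 'rV_n) : {vspace 'rV[C]_n} :=
  (linfun (mulmx v) @: V)%VS.

Definition spread d n (V : {vspace 'M[C]_n}) : Prop :=
  forall v : 'rV_n, v != 0 -> (d < \dim (orbit_space V v))%N.

(* Independent rows B_1, ..., B_s, vD have a right inverse Y, so the perturbed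
   rows multiply with Y to 1 + xZ, which is invertible unless -1/x is an
   eigenvalue of Z. *)
Lemma rank_perturb n (B D : 'M[C]_n) (v : 'rV_n) :
  v *m B = 0 -> ~~ (v *m D <= B)%MS ->
  exists x, (\rank B < \rank (B + x *: D)%R)%N.
Proof.
move=> vB vD; set s := \rank B.
pose S := row_base B *m pinvmx B.
have SB : S *m B = row_base B by rewrite mulmxKpV // eq_row_base.
pose N := col_mx (v *m D) (S *m B).
have Nfree : row_free N.
  rewrite -kermx_eq0; apply/rowV0P => w /sub_kermxP.
  rewrite -(hsubmxK w) mul_row_col SB; set a := lsubmx w; set b := rsubmx w.
  have [->|a0] := eqVneq a 0.
    rewrite mul0mx add0r => /eqP; rewrite mulmx_free_eq0 ?row_base_free //.
    by move/eqP ->; rewrite row_mx0.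
  move=> E; case/negP: vD; rewrite -(eq_row_base B).
  have -> : v *m D = (a 0 0)^-1 *: (a *m (v *m D)).
    rewrite {2}(mx11_scalar a) mul_scalar_mx scalerA mulVf ?scale1r //.
    by apply: contra a0 => /eqP a00; rewrite (mx11_scalar a) a00 raddf0.
  move/eqP: E; rewrite addr_eq0 => /eqP ->.
  by rewrite scalemx_sub // eqmx_opp submxMl.
have [Y NY] := row_freeP Nfree.
pose Z := col_mx (0 : 'M_(1, n)) (S *m D) *m Y.
have [y yroot] : exists y, ~~ root (char_poly Z) y /\ y != 0.
  (* [Z] has size s + 1, so one of these s + 2 distinct nonzero numbers is not an eigenvalue. *)
  pose r := [seq (i.+1)%:R : C | i <- iota 0 (1 + s).+1].
  have : ~~ all (root (char_poly Z)) r.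
    apply/negP => H; have := @max_poly_roots _ (char_poly Z) r.
    rewrite -size_poly_eq0 size_char_poly size_map size_iota ltnn.
    move=> /(_ isT H) F; suff /F : uniq r by [].
    rewrite map_inj_uniq ?iota_uniq // => i j /eqP.
    by rewrite eqr_nat eqSS => /eqP.
  case/allPn => y /mapP[i _ ->] ny; exists i.+1%:R; split=> //.
  by rewrite pnatr_eq0.
case: yroot => ny y0; exists (- y^-1); set x := - y^-1.
have x0 : x != 0 by rewrite oppr_eq0 invr_eq0.
have : row_free (1%:M + x *: Z).
  rewrite -kermx_eq0; apply/rowV0P => w /sub_kermxP.
  rewrite mulmxDr mulmx1 -scalemxAr /x scaleNr => /eqP; rewrite subr_eq0 => /eqP E.
  apply/eqP; apply: contraNT ny => w0; rewrite -eigenvalue_root_char.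
  apply/eigenvalueP; exists w => //.
  by rewrite {2}E scalerA mulfV // scale1r.
have -> : 1%:M + x *: Z = col_mx (v *m D) (S *m (B + x *: D)) *m Y.
  rewrite -NY /N /Z scalemxAl -mulmxDl scale_col_mx add_col_mx scaler0 addr0.
  by rewrite mulmxDr scalemxAr.
move=> /eqP full; suff : (1 + s <= \rank (B + x *: D)%R)%N by [].
rewrite -full; apply: leq_trans (mxrankM_maxl _ _) _; apply: mxrankS.
rewrite col_mx_sub; apply/andP; split; last exact: submxMl.
(* As v B = 0, the row v D lies in the row space of the perturbed matrix. *)
have -> : v *m D = (x^-1 *: v) *m (B + x *: D).
  by rewrite -scalemxAl mulmxDr vB add0r -scalemxAr scalerA mulVf // scale1r.
exact: submxMl.
Qed.

Lemma limg_dim_leq (aT rT : vectType C) (f : 'Hom(aT, rT)) (U : {vspace aT}) :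
  (\dim (f @: U) <= \dim U)%N.
Proof. by rewrite -[leqRHS](limg_ker_dim f) leq_addl. Qed.

Lemma dim_rowspace m n (B : 'M[C]_(m, n)) :
  (\dim (linfun (mulmxr B) @: fullv : {vspace 'rV_n}) <= m)%N.
Proof.
by apply: leq_trans (limg_dim_leq _ _) _; rewrite dimvf /dim /= mul1n.
Qed.

(** A matrix [B] of rank at most d kills some v <> 0. The orbit of v has dimension above d, so it
    leaves the row space of [B], and [rank_perturb] raises the rank. *)
Lemma spread_rank d n (V : {vspace 'M[C]_n}) :
  (0 < n)%N -> spread d V -> exists2 B, B \in V & (d < \rank B)%N.
Proof.
move=> n0 sV.
have dn : (d < n)%N.
  have v0 : (const_mx 1 : 'rV[C]_n) != 0.
    by apply/eqP => /rowP/(_ (Ordinal n0))/eqP; rewrite !mxE oner_eq0.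
  apply: leq_trans (sV _ v0) _; apply: leq_trans (dimvS (subvf _)) _.
  by rewrite dimvf /dim /= mul1n.
suff H s : (s <= d.+1)%N -> exists2 B, B \in V & (s <= \rank B)%N by exact: H.
elim: s => [|s IH] sd; first by exists 0; rewrite ?mem0v.
have [B VB] := IH (ltnW sd).
rewrite leq_eqVlt => /orP[/eqP sB|]; last by exists B.
have : kermx B != 0.
  by rewrite kermx_eq0 /row_free -sB neq_ltn (leq_ltn_trans _ dn).
case/rowV0Pn => v /sub_kermxP vB v0.
have : ~~ (orbit_space V v <= (linfun (mulmxr (row_base B)) @: fullv)%VS)%VS.
  apply: contraTN sd => /dimvS; rewrite -ltnNge => le.
  rewrite ltnS sB.
  exact: leq_trans (sV v v0) (leq_trans le (dim_rowspace _)).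
case/subvPn => _ /memv_imgP[D VD ->]; rewrite lfunE /= => vD.
have [|x Bx] := rank_perturb vB (D := D).
  apply: contra vD; rewrite -(eq_row_base B) => /submxP[w ->].
  by apply/memv_imgP; exists w; rewrite ?memvf // lfunE.
by exists (B + x *: D); rewrite ?sB // memvD // memvZ.
Qed.

(** The kernel has codimension at most t^2 in V, and orbit dimensions drop by at most this
    codimension. *)
Lemma spread_cap_lker d d' t n (V : {vspace 'M[C]_n}) (f : 'Hom('M[C]_n, 'M[C]_t)) :
  (d' + t * t <= d)%N -> spread d V -> spread d' (V :&: lker f).
Proof.
move=> dd sV v v0; rewrite -(ltn_add2r (t * t)).
apply: leq_ltn_trans dd (leq_trans (sV v v0) _).
rewrite -{1}(addv_diff_cap V (lker f)) /orbit_space limgD addvC.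
apply: leq_trans (dimv_add_leqif _ _).1 _; rewrite leq_add2l.
apply: leq_trans (limg_dim_leq _ _) _.
rewrite -(leq_add2l (\dim (V :&: lker f))) dimv_cap_compl -(limg_ker_dim f V).
by rewrite leq_add2l; apply: leq_trans (dimvS (subvf _)) _; rewrite dimvf.
Qed.

(** * Building families that carry all diagonal matrices *)

Lemma common_kernel n t (X : seq 'M[C]_(n, t)) :
  exists2 K : 'M_n, (n <= \rank K + size X * t)%N & forall Y, Y \in X -> K *m Y = 0.
Proof.
elim: X => [|Y X [K rK KX]]; first by exists 1%:M => //; rewrite mxrank1 addn0.
exists (K :&: kermx Y)%MS => [|Z].
  rewrite /= mulSn; have := mxrank_sum_cap K (kermx Y).
  have := rank_leq_col (K + kermx Y)%MS; have := rank_leq_col Y.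
  have := mxrank_ker Y; have := rank_leq_row Y; move: rK; lia.
rewrite inE => /orP[/eqP ->|/KX KZ]; first by apply/sub_kermxP; exact: capmxSr.
by have /submxP[W ->] := capmxSl K (kermx Y); rewrite -mulmxA KZ mulmx0.
Qed.

Definition diag_onto n t (V : {vspace 'M[C]_n}) (U : 'M[C]_(t, n)) : Prop :=
  forall D : 'rV_t, exists2 A, A \in V & U *m A *m U^t* = diag_mx D.

(* Take B in V of large rank with U B U^* = 0. The new row u must be orthogonal
   to 2t + 2 families of t vectors; as B has large rank, its compression to the
   orthogonal complement K is still nonzero, so some u in K has u B u^* <> 0,
   and subtracting multiples of B corrects the new diagonal entry. *)
Lemma diag_onto_extend d n t (V : {vspace 'M[C]_n}) (U : 'M[C]_(t, n)) :
  (0 < n)%N -> (5 * t.+1 ^ 2 <= d)%N -> spread d V -> diag_onto V U ->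
  exists U' : 'M[C]_(1 + t, n), diag_onto V U'.
Proof.
move=> n0 td sV VU.
have [A_ VA UA] : exists2 A_ : 'I_t -> 'M_n, forall s, A_ s \in V &
    forall s, U *m A_ s *m U^t* = diag_mx (delta_mx 0 s).
  have /fin_all_exists2[A_ H1 H2] s := VU (delta_mx 0 s).
  by exists A_.
pose f : 'Hom('M[C]_n, 'M[C]_t) := linfun (mulmxr (U^t*) \o mulmx U).
pose d' := (d - t * t)%N.
have dd : (d' + t * t <= d)%N by rewrite /d'; lia.
have [B /[!memv_cap]/andP[VB]] := spread_rank n0 (spread_cap_lker f dd sV).
rewrite memv_ker lfunE /= => /eqP UB rB.
(* Killing both [Y *m U^t*] and [Y^t* *m U^t*] clears the two off-diagonal blocks of the compression
   of [Y] to [col_mx u U]. *)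
pose X := [:: B *m U^t*; B^t* *m U^t*] ++ [seq A_ s *m U^t* | s : 'I_t] ++
  [seq (A_ s)^t* *m U^t* | s : 'I_t].
have [K rK KX] := common_kernel X.
have sX : size X = (t + t).+2 by rewrite /= size_cat !size_image !card_ord.
(* Each factor [K] costs at most t(2t + 2) in rank, while rank B > d - t^2 >= 5(t + 1)^2 - t^2 >
   2t(2t + 2). *)
have KBK : K *m B *m K^t* != 0.
  rewrite -mxrank_eq0 -lt0n.
  have := mxrank_mul_min K B; have := mxrank_mul_min (K *m B) (K^t*).
  rewrite rank_adjmx; move: rK rB; rewrite sX /d'; nia.
have /existsNP[v vv] : ~ (forall v : 'rV_n, v *m (K *m B *m K^t*) *m v^t* = 0).
  by move=> /polarization/eqP; rewrite (negPf KBK).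
pose u := v *m K; pose b := (u *m B *m u^t*) 0 0.
have b0 : b != 0.
  apply/eqP => b0; apply: vv; rewrite [LHS]mx11_scalar; move: b0.
  by rewrite /b /u adjmxM !mulmxA => ->; rewrite raddf0.
have uX Y : Y *m U^t* \in X -> u *m Y *m U^t* = 0.
  by move=> /KX KY; rewrite /u -!mulmxA KY mulmx0.
have uX' Y : Y^t* *m U^t* \in X -> U *m Y *m u^t* = 0.
  move=> /uX /(congr1 (fun M => M^t*)); rewrite !adjmxM !trmxCK mulmxA => ->.
  by rewrite trmx0 map_mx0.
exists (col_mx u U) => D; rewrite -(hsubmxK D); set x := lsubmx D; set y := rsubmx D.
pose A0 := \sum_s y 0 s *: A_ s.
have V0 : A0 \in V by apply: memv_suml => s _; apply: memvZ.
have UA0 : U *m A0 *m U^t* = diag_mx y.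
  rewrite mulmx_sumr mulmx_suml {2}[y]row_sum_delta linear_sum.
  by apply: eq_bigr => s _; rewrite -scalemxAr -scalemxAl UA linearZ.
have uA0 : u *m A0 *m U^t* = 0.
  rewrite mulmx_sumr mulmx_suml big1 // => s _.
  rewrite -scalemxAr -scalemxAl uX ?scaler0 //.
  by rewrite !mem_cat; apply/or3P/Or32/fintype.imageP; exists s.
have u'A0 : U *m A0 *m u^t* = 0.
  rewrite mulmx_sumr mulmx_suml big1 // => s _.
  rewrite -scalemxAr -scalemxAl uX' ?scaler0 //.
  by rewrite !mem_cat; apply/or3P/Or33/fintype.imageP; exists s.
pose a := (x 0 0 - (u *m A0 *m u^t*) 0 0) / b.
exists (A0 + a *: B); first by rewrite memvD // memvZ.
rewrite tr_col_mx map_row_mx mul_col_mx mul_col_row diag_mx_row.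
rewrite !mulmxDr !mulmxDl -!scalemxAr -!scalemxAl.
rewrite uA0 u'A0 UA0 UB uX ?uX' ?mem_cat ?inE ?eqxx ?orbT //.
rewrite !scaler0 !addr0; congr block_mx.
apply/matrixP => i j; rewrite !ord1 mxE [X in _ + X]mxE [RHS]mxE eqxx mulr1n.
by rewrite -/b divfK // addrC subrK.
Qed.

Lemma clique_of_diag_onto n k (V : {vspace 'M[C]_n}) (U : 'M[C]_(k * k, n)) :
  diag_onto V U -> exists P, quantum_clique k V P.
Proof.
move=> VU; have [T TX] := rank_ones_span k.
exists (range_proj (T *m U)); apply: clique_of_onto => X.
have [D <-] := TX X; have [A VA UA] := VU D.
by exists A; rewrite // adjmxM -UA !mulmxA.
Qed.

Lemma diag_onto_spread d n t (V : {vspace 'M[C]_n}) : (0 < n)%N ->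
  (5 * t ^ 2 <= d)%N -> spread d V -> exists U : 'M[C]_(t, n), diag_onto V U.
Proof.
move=> n0 + sV; elim: t => [|t IH] td.
  exists 0 => D; exists 0; rewrite ?mem0v //.
  by apply/matrixP => -[].
have [|U VU] := IH; first by apply: leq_trans td; rewrite leq_mul2l leq_sqr /=.
exact: diag_onto_extend td sV VU.
Qed.

(** * Greedy diagonalisation *)

Definition congr_space n w (V : {vspace 'M[C]_n}) (T : 'M[C]_(w, n)) :
    {vspace 'M[C]_w} := (linfun (mulmxr (T^t*) \o mulmx T) @: V)%VS.

Lemma congr_spaceP n w (V : {vspace 'M[C]_n}) (T : 'M[C]_(w, n)) B :
  reflect (exists2 A, A \in V & B = T *m A *m T^t*) (B \in congr_space V T).
Proof. by apply: (iffP memv_imgP) => -[A VA ->]; exists A; rewrite // lfunE. Qed.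

Lemma diag_onto_congr n w t (V : {vspace 'M[C]_n}) (T : 'M[C]_(w, n))
    (U : 'M[C]_(t, w)) :
  diag_onto (congr_space V T) U -> diag_onto V (U *m T).
Proof.
move=> VU D; have [_ /congr_spaceP[A VA ->] UA] := VU D.
by exists A; rewrite // adjmxM -UA !mulmxA.
Qed.

Lemma vspace_rows w (L : {vspace 'rV[C]_w}) : exists M : 'M[C]_(\dim L, w),
  row_free M /\ forall x : 'rV_w, x \in L = (x <= M)%MS.
Proof.
pose M : 'M[C]_(\dim L, w) := \matrix_i (vbasis L)`_i.
have ME (y : 'rV_(\dim L)) : y *m M = \sum_i y 0 i *: (vbasis L)`_i.
  by rewrite mulmx_sum_row; apply: eq_bigr => i _; rewrite rowK.
exists M; split=> [|x].
  rewrite -kermx_eq0; apply/rowV0P => y /sub_kermxP; rewrite ME => y0.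
  have /freeP/(_ (fun i => y 0 i) y0) yE := basis_free (vbasisP L).
  by apply/rowP => i; rewrite yE mxE.
apply/idP/submxP => [xL|[y ->]].
  exists (\row_i coord (vbasis L) i x); rewrite ME {1}(coord_vbasis xL).
  by apply: eq_bigr => i _; rewrite mxE.
rewrite ME; apply: memv_suml => i _; apply: memvZ; apply: vbasis_mem.
by apply: mem_nth; rewrite size_tuple.
Qed.

(* Greedy choice: as long as the current subspace T is not spread, pick v in it
   whose orbit under TVT^* has dimension <= d and pass to the orthogonal
   complement of that orbit inside T. *)
Lemma spread_or_diagonal d n m (V : {vspace 'M[C]_n}) :
  (forall A, A \in V -> A^t* \in V) -> (0 < d)%N -> (m * d <= n)%N ->
  (exists w (T : 'M[C]_(w, n)), (0 < w)%N /\ spread d (congr_space V T)) \/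
  (exists U : 'M[C]_(m, n), (forall i, row i U != 0) /\
     forall A, A \in V -> is_diag_mx (U *m A *m U^t*)).
Proof.
move=> Vadj d0 mdn; set spr := (exists w, _).
have [|nspr] := pselect spr; [by left | right].
have cut w (T : 'M[C]_(w, n)) : (0 < w)%N ->
    exists2 v : 'rV_w, v != 0 & (\dim (orbit_space (congr_space V T) v) <= d)%N.
  move=> w0; apply: contrapT => H; apply: nspr; exists w, T; split=> // v v0.
  by rewrite ltnNge; apply/negP => le; apply: H; exists v.
(* Invariant: the rows of [T] stay orthogonal to the orbits of the chosen rows of [U], and each
   choice costs at most d dimensions. *)
have main t : (t <= m)%N -> exists w (T : 'M[C]_(w, n)) (U : 'M[C]_(t, n)),
    [/\ row_free T, (n <= w + t * d)%N, forall i, row i U != 0,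
     forall A, A \in V -> is_diag_mx (U *m A *m U^t*) &
     forall A, A \in V -> T *m A *m U^t* = 0].
  elim: t => [|t IH] tm.
    exists n, 1%:M, 0; split; rewrite ?row_free_unit ?unitmx1 ?addn0 //.
    - by case.
    - by move=> A _; apply/is_diag_mxP => -[].
    - by move=> A _; apply/matrixP => i [].
  have [w [T [U [Tf wn U0 UA TA]]]] := IH (ltnW tm).
  have w0 : (0 < w)%N.
    have : (t.+1 * d <= m * d)%N by rewrite leq_mul2r tm orbT.
    by rewrite mulSn; lia.
  have [v v0 vd] := cut w T w0.
  have [M [Mf ML]] := vspace_rows (orbit_space (congr_space V T) v).
  (* The rows of [K] span the orthogonal complement of the orbit of [v]. *)
  pose K := row_base (kermx (M^t*)).
  have KM : K *m M^t* = 0 by apply/sub_kermxP; rewrite eq_row_base.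
  (* The orbit contains v T A^* T^*, so [K] kills its adjoint T A T^* v^*. *)
  have KT A : A \in V -> K *m T *m A *m (v *m T)^t* = 0.
    move=> /Vadj VA; have : v *m (T *m A^t* *m T^t*) \in
        orbit_space (congr_space V T) v.
      apply/memv_imgP; exists (T *m A^t* *m T^t*); last by rewrite lfunE.
      by apply/congr_spaceP; exists (A^t*).
    rewrite ML => /submxP[c /(congr1 (fun X => X^t*))].
    rewrite !adjmxM !trmxCK !mulmxA => E.
    have -> : K *m T *m A *m T^t* *m v^t* = K *m (T *m A *m T^t* *m v^t*).
      by rewrite !mulmxA.
    by rewrite E mulmxA KM mul0mx.
  have uU A : A \in V -> v *m T *m A *m U^t* = 0.
    by move=> /TA E; rewrite -!mulmxA (mulmxA T) E mulmx0.
  have Uu A : A \in V -> U *m A *m (v *m T)^t* = 0.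
    move=> /Vadj/uU/(congr1 (fun X => X^t*)).
    by rewrite !(adjmxM (v *m T *m _)) adjmxM !trmxCK mulmxA trmx0 map_mx0.
  pose U' : 'M[C]_(1 + t, n) := col_mx (v *m T) U.
  have U'0 i : row i U' != 0.
    case: (split_ordP i) => j ->; last by rewrite rowKd.
    by rewrite rowKu row_id mulmx_free_eq0.
  have U'A A : A \in V -> is_diag_mx (U' *m A *m U'^t*).
    move=> VA; rewrite tr_col_mx map_row_mx mul_col_mx mul_col_row uU // Uu //.
    by rewrite is_diag_block_mx // !eqxx mx11_is_diag UA.
  have TU' A : A \in V -> K *m T *m A *m U'^t* = 0.
    move=> VA; rewrite tr_col_mx map_row_mx mul_mx_row KT //.
    by rewrite -(mulmxA K) -(mulmxA K) TA // mulmx0 row_mx0.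
  exists (\rank (kermx (M^t*))), (K *m T), U'; split=> //.
    by rewrite /row_free mxrankMfree //; exact: row_base_free.
  by rewrite mxrank_ker rank_adjmx (eqP Mf) mulSn; move: wn vd; lia.
have [w [T [U [_ _ U0 UA _]]]] := main m (leqnn m).
by exists U.
Qed.

(** * Selecting coordinates in a space of diagonal matrices *)

(** The all-ones row takes column sums, a linear map that reads off the diagonal of a diagonal
    matrix. *)
Definition diagonals n m (V : {vspace 'M[C]_n}) (U : 'M[C]_(m, n)) :
    {vspace 'rV[C]_m} := (linfun (mulmx (const_mx 1)) @: congr_space V U)%VS.

Lemma diagonalsP n m (V : {vspace 'M[C]_n}) (U : 'M[C]_(m, n)) x :
  (forall A, A \in V -> is_diag_mx (U *m A *m U^t*)) ->
  reflect (exists2 A, A \in V & U *m A *m U^t* = diag_mx x) (x \in diagonals V U).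
Proof.
have one (y : 'rV[C]_m) : const_mx 1 *m diag_mx y = y.
  by apply/rowP => i; rewrite mul_mx_diag !mxE mul1r.
move=> UA; apply: (iffP memv_imgP).
  case=> _ /congr_spaceP[A VA ->] ->; exists A => //; rewrite lfunE /=.
  by have /diag_mxP[y ->] := UA A VA; rewrite one.
case=> A VA E; exists (diag_mx x); last by rewrite lfunE /= one.
by apply/congr_spaceP; exists A.
Qed.

(** A basis matrix of [L] has [\dim L] independent columns, and inverting that square block
    prescribes the chosen coordinates. *)
Lemma coordinates_onto m t (L : {vspace 'rV[C]_m}) : (t <= \dim L)%N ->
  exists2 f : 'I_t -> 'I_m, injective f &
    forall y : 'rV_t, exists2 x, x \in L & forall i, x 0 (f i) = y 0 i.
Proof.
move=> tL; have [M [Mf ML]] := vspace_rows L.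
have Mfull : row_full M^T by rewrite /row_full mxrank_tr.
pose fr := fullrankfun Mfull.
have Nunit : (rowsub fr M^T)^T \in unitmx by rewrite unitmx_tr fullrowsub_unit.
exists (fr \o widen_ord tL).
  by move=> i j /= /fullrankfun_inj /(congr1 val) /= /val_inj.
(* [y'] is [y] padded with zeros. *)
move=> y; pose y' : 'rV_(\dim L) := y *m \matrix_(i, j) (i == j :> nat)%:R.
exists (y' *m invmx (rowsub fr M^T)^T *m M); first by rewrite ML submxMl.
move=> i; have := mulmxKV Nunit y'; rewrite trmx_mxsub trmxK.
rewrite mulmx_colsub => /rowP/(_ (widen_ord tL i)).
rewrite mxE /= => ->; rewrite mxE (bigD1 i) //= mxE eqxx mulr1 big1 ?addr0 //.
move=> j ne; rewrite mxE /= (_ : (j == i :> nat) = false) ?mulr0 //.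
exact/negbTE.
Qed.

Lemma diag_onto_select n m t (V : {vspace 'M[C]_n}) (U : 'M[C]_(m, n)) :
  (forall A, A \in V -> is_diag_mx (U *m A *m U^t*)) ->
  (t <= \dim (diagonals V U))%N -> exists U' : 'M[C]_(t, n), diag_onto V U'.
Proof.
move=> UA /coordinates_onto[f finj fy]; exists (rowsub f U) => y.
have [x /(diagonalsP _ UA)[A VA E] xf] := fy y; exists A => //.
have -> : (rowsub f U)^t* = colsub f (U^t*) by apply/matrixP => i j; rewrite !mxE.
rewrite mul_rowsub_mx mulmx_colsub mul_rowsub_mx E.
by apply/matrixP => i j; rewrite !mxE xf (inj_eq finj).
Qed.
End Compressions.

(** * Colourful Carathéodory and Tverberg *)

Section Tverberg.
Variable R : realType.

Definition simplex (m : nat) (l : 'rV[R]_m) : Prop :=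
  (forall i, 0 <= l 0 i) /\ \sum_i l 0 i = 1.

Definition dotr (n : nat) (u v : 'rV[R]_n) : R := (u *m v^T) 0 0.

Lemma dotrE n (u v : 'rV[R]_n) : dotr u v = \sum_c u 0 c * v 0 c.
Proof. by rewrite /dotr mxE; apply: eq_bigr => c _; rewrite mxE. Qed.

Lemma dotrC n (u v : 'rV[R]_n) : dotr u v = dotr v u.
Proof. by rewrite !dotrE; apply: eq_bigr => c _; rewrite mulrC. Qed.

Lemma dotrDl n (u v w : 'rV[R]_n) : dotr (u + v) w = dotr u w + dotr v w.
Proof. by rewrite /dotr mulmxDl mxE. Qed.

Lemma dotrZl n a (u w : 'rV[R]_n) : dotr (a *: u) w = a * dotr u w.
Proof. by rewrite /dotr -scalemxAl mxE. Qed.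

Lemma dotr_suml n (I : finType) (u : I -> 'rV[R]_n) w :
  dotr (\sum_i u i) w = \sum_i dotr (u i) w.
Proof. by rewrite /dotr mulmx_suml summxE. Qed.

Lemma dotr_mull m n (l : 'rV[R]_m) (S : 'M[R]_(m, n)) w :
  dotr (l *m S) w = \sum_i l 0 i * dotr (row i S) w.
Proof.
by rewrite mulmx_sum_row dotr_suml; apply: eq_bigr => i _; rewrite dotrZl.
Qed.

Lemma dotr_ge0 n (u : 'rV[R]_n) : 0 <= dotr u u.
Proof. by rewrite dotrE; apply: sumr_ge0 => c _; rewrite -expr2 sqr_ge0. Qed.

Lemma dotr_gt0 n (u : 'rV[R]_n) : u != 0 -> 0 < dotr u u.
Proof.
move=> u0; rewrite lt_def dotr_ge0 andbT; apply: contra u0.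
rewrite dotrE psumr_eq0 => [/allP H|c _]; last by rewrite -expr2 sqr_ge0.
apply/eqP/rowP => c; rewrite mxE.
by have := H c (mem_index_enum c); rewrite mulf_eq0 orbb => /eqP.
Qed.

Lemma simplex_delta m (i : 'I_m) : simplex (delta_mx 0 i : 'rV[R]_m).
Proof.
split=> [j|]; first by rewrite mxE; case: (_ && _).
rewrite (bigD1 i) //= mxE !eqxx big1 ?addr0 // => j ne.
by rewrite mxE (negPf ne) andbF.
Qed.

(** The simplex is nonempty and compact, and the squared norm is continuous. *)
Lemma simplex_min m n (S : 'M[R]_(m, n)) : (0 < m)%N ->
  exists2 l : 'rV[R]_m, simplex l &
    forall x, simplex x -> dotr (l *m S) (l *m S) <= dotr (x *m S) (x *m S).
Proof.
move=> m0; pose A : set 'rV[R]_m := [set l | simplex l]%classic.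
have coordc i : continuous (fun l : 'rV[R]_m => l 0 i).
  exact: coord_continuous.
have sumc (I : finType) (F : I -> 'rV[R]_m -> R) :
    (forall i, continuous (F i)) -> continuous (fun l => \sum_i F i l).
  move=> Fc; elim: (index_enum I) => [|i r IH].
    rewrite (_ : (fun _ => _) = fun=> 0); last first.
      by apply/funext => l; rewrite big_nil.
    by move=> x; apply: cst_continuous.
  rewrite (_ : (fun _ => _) = fun l => F i l + \sum_(j <- r) F j l).
    by move=> x; apply: continuousD; [exact: Fc | exact: IH].
  by apply/funext => l; rewrite big_cons.
have [||| l lA lmin] := @EVT_min_rV R m (fun l => dotr (l *m S) (l *m S)) A.
- by exists (delta_mx 0 (Ordinal m0)); apply: simplex_delta.
- apply: bounded_closed_compact.
    exists 1; split => // M M1 l [l0 l1] /=.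
    rewrite [leLHS]/Num.Def.normr /= mx_normrE; apply: bigmax_le.
      exact: le_trans ler01 (ltW M1).
    move=> [a i] _ /=; rewrite ord1 ger0_norm // (le_trans _ (ltW M1)) // -l1.
    by rewrite (bigD1 i) //= lerDl sumr_ge0.
  have -> : A = ((\bigcap_(i in [set: 'I_m]) [set l | 0 <= l 0 i]) `&`
     [set l | \sum_i l 0 i = 1])%classic.
    apply/seteqP; split => l; first by case=> l0 l1; split=> // i _; exact: l0.
    by case=> l0 l1; split=> // i; apply: (l0 i).
  apply: closedI.
    apply: closed_bigI => i _.
    exact: (preimage_closed (fun x _ => coordc i x) (@closed_ge R 0)).
  exact: (preimage_closed (fun x _ => sumc _ _ coordc x) (@closed_eq R 1)).
- apply: continuous_subspaceT.
  rewrite (_ : (fun _ => _) = fun l : 'rV[R]_m => \sum_c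
    (\sum_i l 0 i * S i c) * (\sum_i l 0 i * S i c)); last first.
    by apply/funext => l; rewrite dotrE; apply: eq_bigr => c _; rewrite !mxE.
  have cc c : continuous (fun l : 'rV[R]_m => \sum_i l 0 i * S i c).
    apply: sumc => i y; apply: continuousM; [exact: coordc | exact: cst_continuous].
  by apply: sumc => c y; apply: continuousM; exact: cc.
exists l; first by move: lA; rewrite inE.
by move=> x xA; apply: lmin; rewrite inE.
Qed.

Lemma simplex_segment m (l x : 'rV[R]_m) t : simplex l -> simplex x ->
  0 <= t <= 1 -> simplex (l + t *: (x - l)).
Proof.
move=> [l0 l1] [x0 x1] /andP[t0 t1]; split=> [i|].
  by rewrite !mxE; have := l0 i; have := x0 i; nra.
under eq_bigr => i _ do rewrite !mxE.
by rewrite big_split /= -mulr_sumr sumrB l1 x1 subrr mulr0 addr0.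
Qed.

(** First-order optimality: otherwise a short step from [l] towards [x] would lower the norm. *)
Lemma simplex_min_variation m n (S : 'M[R]_(m, n)) (l : 'rV[R]_m) :
  simplex l ->
  (forall x, simplex x -> dotr (l *m S) (l *m S) <= dotr (x *m S) (x *m S)) ->
  forall x, simplex x -> dotr (l *m S) (l *m S) <= dotr (x *m S) (l *m S).
Proof.
move=> sl lmin x sx; set q := l *m S in lmin *.
pose w := (x - l) *m S.
have Ew : dotr (x *m S) q = dotr q q + dotr w q.
  by rewrite -dotrDl /q /w -mulmxDl addrC subrK.
have [wq|wq] := leP 0 (dotr w q); first by rewrite Ew lerDl.
pose a := - dotr w q; pose D := dotr w w; have D0 : 0 <= D := dotr_ge0 w.
have a0 : 0 < a by rewrite oppr_gt0.
have aD : 0 < a + D by lra.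
(* The summand [a] in the denominator keeps t in (0, 1] even when D = 0; t D < 2a makes the decrease
   strict. *)
pose t : R := a / (a + D).
have taD : t * (a + D) = a by rewrite divfK ?gt_eqF.
have t0 : 0 < t by rewrite divr_gt0.
have t1 : t <= 1 by rewrite ler_pdivrMr // mul1r lerDl.
have := lmin _ (simplex_segment sl sx (t := t) _); rewrite ltW // t1.
move=> /(_ isT); rewrite mulmxDl -scalemxAl -/q -/w.
rewrite dotrDl dotrZl (dotrC q) (dotrC w) !dotrDl !dotrZl (dotrC q w) -/D.
have -> : dotr w q = - a by rewrite opprK.
clearbody t a D.
have pos : 0 < t * (2 * a - t * D) by apply: mulr_gt0 => //; nra.
by clear - pos => H; exfalso; lra.
Qed.

(** The ratio test behind Carathéodory's theorem: move along [c] until the first weight reaches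
    zero. *)
Lemma simplex_dependency m n (S : 'M[R]_(m, n)) (l c : 'rV[R]_m) :
  simplex l -> c != 0 -> \sum_i c 0 i = 0 -> c *m S = 0 ->
  exists2 l', simplex l' /\ l' *m S = l *m S & exists i, l' 0 i = 0.
Proof.
move=> [l0 l1] cn0 c0 cS.
have /existsP[i0 ci0] : [exists i, c 0 i < 0].
  apply: contraNT cn0; rewrite negb_exists => /forallP H.
  apply/eqP/rowP => i; rewrite mxE.
  by rewrite (psumr_eq0P _ c0) // => j _; rewrite leNgt H.
case: (@arg_minP _ _ _ i0 (fun i => c 0 i < 0) (fun i => l 0 i / - c 0 i) ci0).
move=> i ci imin; pose t := l 0 i / - c 0 i.
have t0 : 0 <= t by rewrite divr_ge0 // oppr_ge0 ltW.
exists (l + t *: c); last first.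
  by exists i; rewrite !mxE /t -mulrA invrN mulNr mulVf ?lt_eqF // mulrN1 subrr.
split; last by rewrite mulmxDl -scalemxAl cS scaler0 addr0.
split=> [j|]; last first.
  under eq_bigr => j _ do rewrite !mxE.
  by rewrite big_split /= -mulr_sumr c0 mulr0 addr0.
rewrite !mxE; have [cj|cj] := leP 0 (c 0 j).
  by rewrite addr_ge0 // mulr_ge0.
have := imin j cj; rewrite -/t ler_pdivlMr ?oppr_gt0 //.
by rewrite mulrN lerNl -subr_ge0 opprK addrC.
Qed.

(* Bárány's argument: minimise |sum_i l_i s_{i,j(i)}|^2 over both the weights l
   and the colour choices j, and let q be the minimising point. If q <> 0, no
   minimising l has a zero weight, since that colour could be exchanged for
   one on the far side of the hyperplane orthogonal to q; but m > n gives a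
   dependency along which a weight can be moved to zero without changing q. *)
Lemma colourful_caratheodory m n (J : finType) (s : 'I_m -> J -> 'rV[R]_n) :
  (n < m)%N -> J -> (forall i, \sum_j s i j = 0) ->
  exists (j : 'I_m -> J) (l : 'rV[R]_m),
    simplex l /\ \sum_i l 0 i *: s i (j i) = 0.
Proof.
move=> nm j0 s0.
pose S (j : {ffun 'I_m -> J}) : 'M[R]_(m, n) := \matrix_i s i (j i).
have SE j (l : 'rV[R]_m) : l *m S j = \sum_i l 0 i *: s i (j i).
  by rewrite mulmx_sum_row; apply: eq_bigr => i _; rewrite rowK.
pose f j (l : 'rV[R]_m) := dotr (l *m S j) (l *m S j).
have /choice[L HL] (j : {ffun 'I_m -> J}) :
    exists l, simplex l /\ forall x, simplex x -> f j l <= f j x.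
  have [|l sl lmin] := simplex_min (S j); first by case: (m) nm.
  by exists l.
case: (@arg_minP _ _ _ [ffun=> j0] xpredT (fun j => f j (L j)) isT) => j _ jmin.
have {jmin} jmin j' x : simplex x -> f j (L j) <= f j' x.
  by move=> sx; apply: le_trans (jmin j' isT) _; apply: (HL j').2.
have [sl _] := HL j; set l := L j in jmin sl; pose q := l *m S j.
exists j, l; split => //; rewrite -SE -/q; apply/eqP/negP => /negP q0.
have qq : 0 < dotr q q by exact: dotr_gt0.
have pos l' : simplex l' -> l' *m S j = q -> forall i, l' 0 i != 0.
  move=> sl' l'q i; apply/eqP => l'i.
  have [j1 j1q] : exists j1, dotr (s i j1) q <= 0.
    apply/existsP; apply: contraT; rewrite negb_exists => /forallP H.
    have : 0 < \sum_j1 dotr (s i j1) q.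
      rewrite (bigD1 j0) //=; apply: ltr_wpDr; last by rewrite ltNge H.
      by apply: sumr_ge0 => j1 _; rewrite ltW // ltNge H.
    by rewrite -dotr_suml s0 /dotr mul0mx mxE ltxx.
  pose jj := [ffun x => if x == i then j1 else j x].
  have l'jj : l' *m S jj = q.
    rewrite -l'q !SE; apply: eq_bigr => x _; rewrite ffunE.
    by case: eqP => // ->; rewrite l'i !scale0r.
  have := @simplex_min_variation _ _ (S jj) l' sl' _ _ (simplex_delta i).
  rewrite l'jj -rowE rowK ffunE eqxx => H.
  suff : dotr q q <= 0 by rewrite leNgt qq.
  by apply: le_trans (H _) j1q => x; exact: jmin.
(* The nonnegative terms l_k (<s_k, q> - |q|^2) sum to zero and no l_k vanishes, so each bracket is
   zero. *)
have rowq i : dotr (row i (S j)) q = dotr q q.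
  have ge k : 0 <= l 0 k * (dotr (row k (S j)) q - dotr q q).
    apply: mulr_ge0; first exact: sl.1.
    rewrite subr_ge0 rowE; apply: simplex_min_variation (simplex_delta k) => //.
    by move=> x; exact: jmin.
  have /psumr_eq0P H : \sum_k l 0 k * (dotr (row k (S j)) q - dotr q q) = 0.
    under eq_bigr => k _ do rewrite mulrBr.
    by rewrite sumrB -dotr_mull -mulr_suml sl.2 mul1r subrr.
  have /eqP := H (fun k _ => ge k) i isT.
  by rewrite mulf_eq0 (negPf (pos l sl _ i)) //= subr_eq0 => /eqP.
have : kermx (S j) != 0.
  rewrite kermx_eq0 /row_free neq_ltn.
  by rewrite (leq_ltn_trans (rank_leq_col _) nm).
case/rowV0Pn => c /sub_kermxP cS c0.
(* Pairing c S = 0 with q gives (sum of c) |q|^2 = 0 by [rowq], so the entries of [c] sum to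
   zero. *)
have [|l' [sl' l'q] [i l'i]] := simplex_dependency sl c0 _ cS.
  have : dotr (c *m S j) q = 0 by rewrite cS /dotr mul0mx mxE.
  rewrite dotr_mull; under eq_bigr => i _ do rewrite rowq.
  by rewrite -mulr_suml => /eqP; rewrite mulf_eq0 (gt_eqF qq) orbF => /eqP.
by have := pos l' sl' l'q i; rewrite l'i eqxx.
Qed.

(* Sarkaria's tensor trick: apply the colourful theorem to the vectors
   (e_b - (1/k, ..., 1/k)) (x) p_i, indexed by points i and colours b. *)
Lemma tverberg m n k (p : 'M[R]_(m, n)) : (0 < k)%N -> (k * n < m)%N ->
  exists (j : 'I_m -> 'I_k) (l : 'rV[R]_m), simplex l /\
    forall a c, \sum_(i | j i == a) l 0 i * p i c =
                k%:R^-1 * \sum_i l 0 i * p i c.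
Proof.
move=> k0 knm; have kR : k%:R != 0 :> R by rewrite pnatr_eq0 -lt0n.
pose s (i : 'I_m) (b : 'I_k) : 'rV[R]_(k * n) :=
  mxvec (\matrix_(a, c) (((a == b)%:R - k%:R^-1) * p i c)).
have s0 i : \sum_b s i b = 0.
  rewrite -linear_sum; apply/eqP; rewrite mxvec_eq0; apply/eqP/matrixP => a c.
  rewrite summxE !mxE; under eq_bigr => b _ do rewrite mxE.
  rewrite -mulr_suml sumrB sumr_const card_ord -[X in _ - X]mulr_natr mulVf //.
  rewrite (bigD1 a) //= eqxx big1 ?addr0 ?subrr ?mul0r // => b.
  by rewrite eq_sym => /negPf ->.
have [j [l [sl E]]] := colourful_caratheodory knm (Ordinal k0) s0.
exists j, l; split => // a c; apply/eqP; rewrite -subr_eq0; apply/eqP.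
have /rowP/(_ (mxvec_index a c)) := E.
rewrite summxE mxE => E'; rewrite -[RHS]E' mulr_sumr big_mkcond -sumrB.
apply: eq_bigr => i _; rewrite mxE mxvecE mxE eq_sym.
by case: eqP => _; rewrite ?sub0r ?mulrBl ?mul1r ?mulrBr ?mulNr ?mulrN mulrCA.
Qed.

(** * Complex Tverberg partitions and anticliques *)

Lemma complex_tverberg m n k (p : 'M[complex R]_(m, n)) :
  (0 < k)%N -> (k * (n + n) < m)%N ->
  exists (j : 'I_m -> 'I_k) (l : 'I_m -> complex R),
    [/\ forall i, 0 <= l i, \sum_i l i = 1 &
    forall a c, \sum_(i | j i == a) l i * p i c = k%:R^-1 * \sum_i l i * p i c].
Proof.
move=> k0 knm.
(* Real and imaginary parts become separate coordinates, which doubles the dimension; the weights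
   stay real. *)
pose q := row_mx (map_mx (@complex.Re R) p) (map_mx (@complex.Im R) p).
have [j [l [[l0 l1] E]]] := tverberg q k0 knm.
exists j, (fun i => real_complex R (l 0 i)); split => [i||a c].
- by rewrite (lecR 0).
- by rewrite -rmorph_sum l1.
have Ere := E a (lshift n c); have Eim := E a (rshift n c).
have split_sum (P : pred 'I_m) : \sum_(i | P i) real_complex R (l 0 i) * p i c =
    real_complex R (\sum_(i | P i) l 0 i * q i (lshift n c)) +
    'i%C * real_complex R (\sum_(i | P i) l 0 i * q i (rshift n c)).
  rewrite !rmorph_sum mulr_sumr -big_split; apply: eq_bigr => i _ /=.
  rewrite /q row_mxEl row_mxEr !mxE !rmorphM /= mulrCA -mulrDr.
  by rewrite -complexE.
rewrite !split_sum Ere Eim !rmorphM /= fmorphV rmorph_nat.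
by rewrite mulrDr mulrCA.
Qed.

(** Row a of [S] carries the square roots of the weights of class a. Disjoint supports make S
    diag(x) S^* diagonal, and its entries are the class sums of l_i x_i, which are equal by
    Tverberg. *)
Lemma anticlique_of_diagonal m n k (V : {vspace 'M[complex R]_n})
    (U : 'M[complex R]_(m, n)) :
  (0 < k)%N -> 1%:M \in V -> (forall i, row i U != 0) ->
  (forall A, A \in V -> is_diag_mx (U *m A *m U^t*)) ->
  (k * (\dim (diagonals V U) + \dim (diagonals V U)) < m)%N ->
  exists P, quantum_anticlique k V P.
Proof.
move=> k0 V1 U0 UA km; set L := diagonals V U in km.
have [M [_ ML]] := vspace_rows L.
(* Row i of [M^T] is the i-th coordinate functional on [L]. *)
have [j [l [l0 l1 E]]] := complex_tverberg M^T k0 km.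
have {}E x a : x \in L ->
    \sum_(i | j i == a) l i * x 0 i = k%:R^-1 * \sum_i l i * x 0 i.
  rewrite ML => /submxP[y ->].
  have lin (P : pred 'I_m) : \sum_(i | P i) l i * (y *m M) 0 i =
      \sum_c y 0 c * \sum_(i | P i) l i * M^T i c.
    under eq_bigr => i _ do rewrite mxE mulr_sumr.
    rewrite exchange_big; apply: eq_bigr => c _; rewrite mulr_sumr.
    by apply: eq_bigr => i _; rewrite mxE mulrCA.
  rewrite !lin mulr_sumr; apply: eq_bigr => c _; rewrite E.
  by rewrite mulrCA.
pose S : 'M[complex R]_(k, m) :=
  \matrix_(a, i) (if j i == a then sqrtC (l i) else 0).
pose avg (x : 'rV[complex R]_m) := k%:R^-1 * \sum_i l i * x 0 i.
have SS x : x \in L -> S *m diag_mx x *m S^t* = (avg x)%:M.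
  move=> xL; apply/matrixP => a b; rewrite mul_mx_diag !mxE.
  transitivity (\sum_(i | j i == a) (l i * x 0 i) *+ (a == b)).
    rewrite [RHS]big_mkcond; apply: eq_bigr => i _; rewrite !mxE.
    case: (j i =P a) => [->|_]; last by rewrite !mul0r.
    case: eqP => _; last by rewrite rmorph0 mulr0.
    rewrite mulr1n mulrAC conj_Creal ?ger0_real ?sqrtC_ge0 //.
    by rewrite -expr2 sqrtCK.
  by rewrite sumrMnl E.
pose T := S *m U.
have TA A : A \in V -> exists2 x, U *m A *m U^t* = diag_mx x &
    T *m A *m T^t* = (avg x)%:M.
  move=> VA; have /diag_mxP[x Ex] := UA A VA; exists x => //.
  have xL : x \in L by apply/(diagonalsP _ UA); exists A.
  by rewrite -(SS x xL) -Ex /T adjmxM !mulmxA.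
(* At A = 1 the entries of [x1] are the squared norms of the rows of [U]. They are positive, so T
   T^* is a nonzero scalar and [T] is row-free. *)
have [x1 Ex1] := TA _ V1; rewrite mulmx1 => TT.
have x1E i : x1 0 i = (row i U *m (row i U)^t*) 0 0.
  have /matrixP/(_ i i) := Ex1; rewrite mulmx1 [RHS]mxE eqxx mulr1n => <-.
  by rewrite !mxE; apply: eq_bigr => c _; rewrite !mxE.
have x1_gt0 i : 0 < x1 0 i.
  by rewrite x1E -dotmxE; apply: dotmx_is_dotmx.
have c0 : avg x1 != 0.
  rewrite mulf_neq0 ?invr_eq0 ?pnatr_eq0 -?lt0n //.
  apply: contra_eq_neq l1 => /psumr_eq0P H.
  rewrite big1 ?(eq_sym 0) ?oner_eq0 // => i _.
  have /eqP := H (fun i _ => mulr_ge0 (l0 i) (ltW (x1_gt0 i))) i isT.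
  by rewrite mulf_eq0 (gt_eqF (x1_gt0 i)) orbF => /eqP.
exists (range_proj T); apply: anticlique_of_scalar => // [|A VA].
  apply/row_freeP; exists ((avg x1)^-1 *: T^t*).
  by rewrite -scalemxAr TT scale_scalar_mx mulVf.
have [x _ ->] := TA A VA; exists (avg x / avg x1).
by rewrite TT scale_scalar_mx divfK.
Qed.
End Tverberg.

Theorem theorem4p5 (R : realType) (k : nat) (hk : (1 <= k)%N)
    (V : {vspace 'M[complex R]_(8 * k ^ 11)}) (hV : operator_system V) :
  (exists P : 'M[complex R]_(8 * k ^ 11), quantum_clique k V P) \/
  (exists P : 'M[complex R]_(8 * k ^ 11), quantum_anticlique k V P).
Proof.
have [V1 Vadj] := hV.
have d0 : (0 < 8 * k ^ 4)%N by rewrite muln_gt0 expn_gt0 hk.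
have md : (k ^ 7 * (8 * k ^ 4) <= 8 * k ^ 11)%N by rewrite mulnCA -expnD.
have [[w [T [w0 sT]]]|[U [U0 UA]]] := spread_or_diagonal Vadj d0 md.
  (* The bound 5 t^2 <= d at t = k^2. *)
  have kd : (5 * (k * k) ^ 2 <= 8 * k ^ 4)%N.
    by rewrite mulnn -expnM leq_mul2r orbT.
  have [U VU] := diag_onto_spread w0 kd sT.
  by left; apply: clique_of_diag_onto (diag_onto_congr VU).
have [kD|Dk] := leqP (k * k) (\dim (diagonals V U)).
  have [U' VU'] := diag_onto_select UA kD.
  by left; apply: clique_of_diag_onto VU'.
right; apply: anticlique_of_diagonal UA _ => //.
(* From r <= k^2 - 1 follows 2r <= 2k^2 - 2 < k^4 <= k^6. *)
move: Dk; move: (\dim _) => r rk; rewrite expnS ltn_pmul2l //.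
apply: leq_trans (_ : (k * k) ^ 2 <= _)%N; first by nia.
by rewrite mulnn -expnM leq_pexp2l.
Qed.
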